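(* Let $p>5$ be a prime. Then there exist infinitely many square-free integers $d>0$ such that $p$ is $WSS(d)^*$. That is, there are infinitely many square-free integers $d>0$ for which there exist integers $A,B$ with $p\nmid B$ and an integer $s\ge 1$ such that $A^2-4B=d s^2$ and such that the sequence $(F_n)_{n\ge 0}$ defined by $F_0=0$, $F_1=1$, $F_{n}=-AF_{n-1}-BF_{n-2}$ for $n\ge 2$ has the same period modulo $p$ and modulo $p^2$, i.e. $k(p)=k(p^2)$.
   Context: For integers $A,B$ consider the recurrence $F_n=-AF_{n-1}-BF_{n-2}$ ($n\ge 2$), $F_0=0$, $F_1=1$, with characteristic polynomial $X^2+AX+B$ of discriminant $A^2-4B$. For an integer $m>1$ coprime to $B$, $k(m)$ denotes the (least) period of this sequence modulo $m$: the smallest integer $k\ge 1$ with $F_{n+k}\equiv F_n \pmod m$ for all $n\ge 0$. For a square-free integer $d>0$, a prime $p$ is called $WSS(d)^*$ if there is such a recurrence whose characteristic polynomial has discriminant equal to $d$ up to a square factor and for which $k(p^2)=k(p)$. *)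

(* Defs.v *)
From HB Require Import structures.
From mathcomp Require Import all_boot all_order all_algebra.
From mathcomp Require Import classical_sets cardinality.

Set Implicit Arguments.
Unset Strict Implicit.
Unset Printing Implicit Defensive.

Import GRing.Theory Num.Theory.
Local Open Scope ring_scope.

Fixpoint lucas (A B : int) (n : nat) : int :=
  match n with
  | 0 => 0
  | n1.+1 => match n1 with
             | 0 => 1
             | n2.+1 => - A * lucas A B n1 - B * lucas A B n2
             end
  end.

(* A relation rather than a function, since the sequence modulo m need not be
   purely periodic when m is not coprime to B. *)
Definition is_period (A B : int) (m k : nat) : Prop :=
  (0 < k)%N /\
  forall n : nat, (lucas A B (n + k) = lucas A B n %[mod m])%Z.

Definition is_least_period (A B : int) (m k : nat) : Prop :=
  is_period A B m k /\ forall j : nat, is_period A B m j -> (k <= j)%N.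

Definition squarefree (d : int) : Prop :=
  forall x : int, (x ^+ 2 %| d)%Z -> `|x|%N = 1%N.

(* The hypothesis on B makes the least periods modulo p and p ^ 2 exist; the
   common value k expresses that they are equal. *)
Definition WSS_star (d : int) (p : nat) : Prop :=
  exists A B : int,
    [/\ ~~ (p %| B)%Z,
        exists s : int, 1 <= s /\ A ^+ 2 - 4 * B = d * s ^+ 2
      & exists k : nat,
          is_least_period A B p k /\ is_least_period A B (p ^ 2)%N k].

(* Main.v *)
Require Import Defs.
From HB Require Import structures.
From mathcomp Require Import all_boot all_order all_algebra.
From mathcomp Require Import classical_sets cardinality.
From mathcomp Require Import zify ring.

Import GRing.Theory.

(** If [D = 1 %[mod p ^ 2]], then the recurrence with [A = 0] and [B = - D] is
    0, 1, 0, 1, ... modulo both [p] and [p ^ 2], so it has period 2 for both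
    moduli, and its discriminant is [4 * D].  For [D = 1 + (p * N`!) ^ 2], which
    is not a square, the square-free part of [D] is greater than 1 and coprime to
    [N`!], hence greater than [N]. *)

Local Open Scope classical_set_scope.
Local Open Scope ring_scope.

Lemma lucas0_is_least_period (D : int) (m : nat) :
  (1 < m)%N -> (m %| D - 1)%Z -> is_least_period 0 (- D) m 2.
Proof.
move=> m_gt1 mD; split; first split=> // n.
  apply/eqP; rewrite addn2 /= eqz_mod_dvd.
  have -> : - 0 * lucas 0 (- D) n.+1 - - D * lucas 0 (- D) n - lucas 0 (- D) n
            = (D - 1) * lucas 0 (- D) n by ring.
  exact: dvdz_mulr.
(* Period 1 would make the terms of index 0 and 1 congruent, so [m] would divide 1. *)
move=> [|[|j]] // [] // _ /(_ 0%N) /eqP.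
by rewrite eqz_mod_dvd /= subr0 dvdzE dvdn1 => /eqP m1; lia.
Qed.

(** Strong induction: a square factor [x ^ 2] with [x] different from 1 leaves a smaller positive
    quotient, and [x] is absorbed into [s]. *)
Lemma squarefree_decomp (D : nat) : (0 < D)%N ->
  exists d s : nat, [/\ (0 < s)%N, D = (d * s ^ 2)%N & squarefree d].
Proof.
elim/ltn_ind: D => D IH D_gt0.
(* Any [x] whose square divides [D] is at most [D], so square-freeness is a finite, decidable
   check. *)
have [sqf|] := boolP [forall x : 'I_D.+1, (x ^ 2 %| D) ==> (x == 1 :> nat)]%N.
  exists D, 1%N; split=> //; first by rewrite muln1.
  move=> x; rewrite dvdzE abszX /= => xD.
  have x_le : (`|x| < D.+1)%N by have := dvdn_leq D_gt0 xD; nia.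
  by move/forallP: sqf => /(_ (Ordinal x_le)) /=; rewrite xD /= => /eqP.
case/forallPn => x; rewrite negb_imply => /andP[/dvdnP[q Dq] x_neq1].
have [||d [s [s_gt0 qE sqf]]] := IH q; [nia | nia |].
exists d, (s * x)%N; split=> //; first by nia.
by rewrite expnMn mulnA -qE.
Qed.

(** The number lies strictly between the squares of [M] and [M + 1]. *)
Lemma add1_sqr_neq_sqr (M s : nat) : (0 < M)%N -> (1 + M ^ 2)%N <> (s ^ 2)%N.
Proof. by move=> M_gt0 E; have [sM|Ms] := leqP s M; nia. Qed.

Lemma WSS_star_unbounded (p N : nat) : prime p -> (2 < p)%N ->
  exists d : nat, [/\ (N < d)%N, squarefree d & WSS_star d p].
Proof.
move=> p_prime p_gt2; set M := (p * N`!)%N.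
have M_gt0 : (0 < M)%N by rewrite muln_gt0 fact_gt0 prime_gt0.
have [//|d [s [s_gt0 DE sqf]]] := @squarefree_decomp (1 + M ^ 2)%N.
have D1 m : (m %| p ^ 2)%N -> (m %| Posz (1 + M ^ 2) - 1)%Z.
  move=> mp; have -> : Posz (1 + M ^ 2) - 1 = Posz (M ^ 2)%N by lia.
  by rewrite dvdzE /= expnMn dvdn_mulr.
have p_dvd : (p %| p ^ 2)%N by exact: dvdn_exp.
exists d; split=> //.
  (* If [d <= N], then [d] divides [N!], hence both [M ^ 2] and [1 + M ^ 2]; so [d = 1] and
     [1 + M ^ 2] would be a square. *)
  rewrite ltnNge; apply/negP => d_leN.
  have d_gt0 : (0 < d)%N by case: (d) DE.
  have dM : (d %| M ^ 2)%N by rewrite dvdn_exp ?dvdn_mull ?dvdn_fact ?d_gt0.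
  have : (d %| 1 + M ^ 2)%N by rewrite DE dvdn_mulr.
  rewrite dvdn_addl // dvdn1 => /eqP d1.
  by apply: (@add1_sqr_neq_sqr M s M_gt0); rewrite DE d1 mul1n.
exists 0, (- Posz (1 + M ^ 2)); split.
- rewrite dvdzE abszN /= dvdn_addl; last by rewrite expnMn dvdn_mulr.
  by rewrite dvdn1; apply/eqP => p1; rewrite p1 in p_gt2.
- exists (2 * Posz s); split; first by lia.
  by rewrite DE PoszM -[Posz (s ^ 2)]/(Posz (s * s)) PoszM; ring.
- exists 2%N; split; apply: lucas0_is_least_period; rewrite ?D1 //.
    exact: prime_gt1.
  by have := p_gt2; nia.
Qed.

(** The sum of the absolute values over a finite list bounds each of its entries. *)
Lemma infinite_set_int (S : set int) :
  (forall N : nat, exists2 d : nat, (N < d)%N & S d) -> infinite_set S.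
Proof.
move=> S_unbounded /finite_seqP [s Ss].
have [d d_gt] := S_unbounded (\sum_(x <- s) `|x|)%N.
rewrite Ss /= => d_in; move: d_gt.
by rewrite (big_rem _ d_in) /= ltnNge leq_addr.
Qed.

Theorem mainTheorem1 (p : nat) (p_prime : prime p) (p_gt5 : (5 < p)%N) :
  infinite_set [set d : int | [/\ 0 < d, squarefree d & WSS_star d p]].
Proof.
apply: infinite_set_int => N.
have [|d [d_gt sqf wss]] := @WSS_star_unbounded p N p_prime; first by lia.
by exists d => //; split=> //; lia.
Qed.
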